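(* Let $M$ be a left $R$-module which is projective in $\sigma[M]$ and such that $\Lambda^{fi}(M)$ is compact. Consider the following conditions: (a) $M$ is a strongly harmonic module. (b) $\Lambda^{fi}(M)$ is normal. (c) $\Lambda^{fi}(M)_\mu$ is a normal lattice. (d) $Spec(M)$ is a normal space. Then the implications (a)$\Rightarrow$(b)$\Rightarrow$(c)$\Leftrightarrow$(d) hold. If in addition $0=\bigcap Max^{fi}(M)$, then the four conditions are equivalent.
   Context: $R$ is an associative ring with identity; modules are unital left $R$-modules. A submodule $N\leq M$ is fully invariant if $f(N)\subseteq N$ for all $f\in\mathrm{End}_R(M)$; $\Lambda^{fi}(M)$ is the complete lattice of fully invariant submodules of $M$ ordered by inclusion, and $Max^{fi}(M)$ is the set of its coatoms (maximal proper elements). $\sigma[M]$ is the full subcategory of $R$-Mod of all modules that embed in a quotient of some direct sum $M^{(X)}$. $M$ is $N$-projective if for every epimorphism $\rho\colon N\to X$ and every homomorphism $\alpha\colon M\to X$ there is $\beta\colon M\to N$ with $\rho\beta=\alpha$; $M$ is projective in $\sigma[M]$ if it is $N$-projective for every $N\in\sigma[M]$. For $N,L\leq M$ put $N_ML=\sum\{f(N)\mid f\in\mathrm{Hom}_R(M,L)\}$. $M$ is strongly harmonic if for every two distinct $N,L\in Max^{fi}(M)$ there exist $N',L'\in\Lambda^{fi}(M)$ with $L'\nleq L$, $N'\nleq N$ and $L'_MN'=0$. $\Lambda^{fi}(M)$ is normal if for all $A,B\in\Lambda^{fi}(M)$ with $A+B=M$ there exist $A',B'\in\Lambda^{fi}(M)$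 with $A+B'=M=A'+B$ and $A'_MB'=0$. $\Lambda^{fi}(M)$ is compact if whenever $M=\sum_{i\in I}N_i$ with all $N_i\in\Lambda^{fi}(M)$, there is a finite $F\subseteq I$ with $M=\sum_{i\in F}N_i$. $Spec(M)$ is the set of proper $P\in\Lambda^{fi}(M)$ such that $N_ML\leq P$ with $N,L\in\Lambda^{fi}(M)$ implies $N\leq P$ or $L\leq P$, with open sets $\mathcal{U}(N)=\{P\in Spec(M)\mid N\nleq P\}$, $N\in\Lambda^{fi}(M)$. The multiplicative nucleus $\mu\colon\Lambda^{fi}(M)\to\Lambda^{fi}(M)$ is $\mu(N)=\sum\{K\in\Lambda^{fi}(M)\mid\mathcal{U}(K)\subseteq\mathcal{U}(N)\}$, i.e. $\mu(N)$ is the intersection of all $P\in Spec(M)$ with $N\leq P$ (equal to $M$ if there are none). $\Lambda^{fi}(M)_\mu=\{N\in\Lambda^{fi}(M)\mid\mu(N)=N\}$, with join $\mu(\sum N_i)$, bottom $\mu(0)$ and product $\mu(N_ML)=N\cap L$; it is normal if for all $A,B$ in it with $\mu(A+B)=M$ there exist $A',B'$ in it with $\mu(A+B')=M=\mu(A'+B)$ and $A'\cap B'=\mu(0)$. A topological space is normal if any two disjoint closed subsets are contained respectively in disjoint open subsets (no $T_1$ assumption). *)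

(* Defs.v *)
From HB Require Import structures.
From mathcomp Require Import all_boot all_algebra.
From mathcomp Require Import boolp classical_sets functions cardinality topology.

Set Implicit Arguments.
Unset Strict Implicit.
Unset Printing Implicit Defensive.

Import GRing.Theory.
Local Open Scope classical_set_scope.
Local Open Scope ring_scope.

(* M^(X) is realised as the submodule of finitely supported functions in M^X. *)
Section DirectSum.
Variables (R : pzRingType) (X : Type) (M : lmodType R).

Definition finsupp : {pred X -> M} :=
  mem [set f : X -> M | finite_set [set x | f x != 0]].

Fact finsupp_subsemimod_closed : GRing.subsemimod_closed finsupp.
Proof.
split; first split.
- rewrite inE /=; suff -> : [set x : X | (0 : X -> M) x != 0] = set0 by [].
  by rewrite -subset0 => x /=; rewrite eqxx.
- move=> f g; rewrite !inE /= => Ff Fg.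
  apply: (@sub_finite_set _ _ ([set x | f x != 0] `|` [set x | g x != 0])).
    move=> x /= fgx; have [fx0|] := eqVneq (f x) 0; last by left.
    by right; apply: contra_neq fgx => gx0; rewrite fctE fx0 gx0 addr0.
  by rewrite finite_setU.
- move=> a f; rewrite !inE /=; apply: sub_finite_set => x /=.
  by apply: contra_neq => fx0; rewrite fctE fx0 scaler0.
Qed.

Record dsum := DSum { dsum_val :> X -> M; _ : dsum_val \in finsupp }.

HB.instance Definition _ := [isSub for dsum_val].
HB.instance Definition _ := [Choice of dsum by <:].
HB.instance Definition _ :=
  GRing.SubChoice_isSubLmodule.Build R (X -> M) finsupp dsum
    finsupp_subsemimod_closed.

End DirectSum.

(* A quotient of M^(X) is presented as a surjection p : M^(X) -> Q. *)
Definition in_sigma (R : pzRingType) (M N : lmodType R) : Prop :=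
  exists (X : Type) (Q : lmodType R) (p : {linear dsum X M -> Q})
    (i : {linear N -> Q}), set_surj setT setT p /\ injective i.

Definition rel_projective (R : pzRingType) (M N : lmodType R) : Prop :=
  forall (X : lmodType R) (rho : {linear N -> X}) (alpha : {linear M -> X}),
    set_surj setT setT rho ->
    exists beta : {linear M -> N}, rho \o beta =1 alpha.

Definition projective_in_sigma (R : pzRingType) (M : lmodType R) : Prop :=
  forall N : lmodType R, in_sigma M N -> rel_projective M N.

Section FullyInvariant.
Variables (R : pzRingType) (M : lmodType R).
Implicit Types (N L K P A B : set M) (F : set (set M)).

Definition submodule N : Prop := GRing.submod_closed (mem N).

Definition fi_lattice : set (set M) :=
  [set N | submodule N /\ forall f : {linear M -> M}, f @` N `<=` N].

Definition fi_max : set (set M) :=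
  [set N | [/\ fi_lattice N, N <> setT &
    forall K, fi_lattice K -> N `<=` K -> K <> setT -> K = N]].

(* The sum of the members of F: all finite sums of elements of their union. *)
Definition msum F : set M :=
  [set x | exists2 s : seq M,
    (forall y, y \in s -> exists2 N, F N & N y) & x = \sum_(y <- s) y].

Definition madd A B : set M := [set a + b | a in A & b in B].

(* Hom_R(M, L) is the set of endomorphisms of M with range in L. *)
Definition mprod N L : set M :=
  msum [set f @` N | f in [set f : {linear M -> M} | range f `<=` L]].

Definition strongly_harmonic : Prop :=
  forall N L, fi_max N -> fi_max L -> N <> L ->
    exists N' L', [/\ fi_lattice N', fi_lattice L', ~ L' `<=` L, ~ N' `<=` N &
      mprod L' N' = [set 0]].

Definition fi_normal : Prop :=
  forall A B, fi_lattice A -> fi_lattice B -> madd A B = setT ->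
    exists A' B', [/\ fi_lattice A', fi_lattice B', madd A B' = setT,
      madd A' B = setT & mprod A' B' = [set 0]].

Definition fi_compact : Prop :=
  forall (I : Type) (N : I -> set M), (forall i, fi_lattice (N i)) ->
    msum (range N) = setT ->
    exists2 F : set I, finite_set F & msum (N @` F) = setT.

Definition prime_submodule P : Prop :=
  [/\ fi_lattice P, P <> setT &
    forall N L, fi_lattice N -> fi_lattice L -> mprod N L `<=` P ->
      N `<=` P \/ L `<=` P].

Definition spectrum : Type := {P : set M | prime_submodule P}.

Definition spec_open N : set spectrum := [set P | ~ N `<=` sval P].

Definition mu N : set M :=
  msum [set K | fi_lattice K /\ spec_open K `<=` spec_open N].

Definition fi_lattice_mu : set (set M) := [set N | fi_lattice N /\ mu N = N].

Definition fi_mu_normal : Prop :=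
  forall A B, fi_lattice_mu A -> fi_lattice_mu B -> mu (madd A B) = setT ->
    exists A' B', [/\ fi_lattice_mu A', fi_lattice_mu B',
      mu (madd A B') = setT, mu (madd A' B) = setT & A' `&` B' = mu [set 0]].

Definition spec_topology : set (set spectrum) :=
  [set U | exists2 N, fi_lattice N & U = spec_open N].

Lemma submoduleP N : submodule N <->
  N 0 /\ forall a u v, N u -> N v -> N (a *: u + v).
Proof.
split=> -[N0 Nlin]; split.
- by move: N0; rewrite inE.
- by move=> a u v Nu Nv; move: (Nlin a u v); rewrite !inE; apply.
- by rewrite inE.
- by move=> a u v; rewrite !inE; exact: Nlin.
Qed.

Lemma submodule_sum N (s : seq M) : submodule N ->
  (forall y, y \in s -> N y) -> N (\sum_(y <- s) y).
Proof.
move=> /submoduleP[N0 Nlin] sN; rewrite big_seq.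
elim/big_ind: _ => // x y Nx Ny.
by rewrite -[x]scale1r; exact: Nlin.
Qed.

Lemma msum_sub F N : submodule N -> (forall K, F K -> K `<=` N) ->
  msum F `<=` N.
Proof.
move=> sN FN x [s sF ->]; apply: submodule_sum => // y /sF[K /FN]; exact.
Qed.

Lemma sub_msum F N : F N -> N `<=` msum F.
Proof.
move=> FN x Nx; exists [:: x]; last by rewrite big_seq1.
by move=> y; rewrite inE => /eqP ->; exists N.
Qed.

Lemma fi_latticeT : fi_lattice setT.
Proof. by split=> //; apply/submoduleP. Qed.

Lemma fi_lattice_msum F : (forall N, F N -> submodule N) ->
  (forall (f : {linear M -> M}) N, F N -> F (f @` N) \/ f @` N `<=` N) ->
  fi_lattice (msum F).
Proof.
move=> Fsub Ff; split.
  apply/submoduleP; split; first by exists [::]; rewrite ?big_nil.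
  move=> a u v [s sF ->] [t tF ->].
  exists ([seq a *: y | y <- s] ++ t); last first.
    by rewrite big_cat big_map scaler_sumr.
  move=> y; rewrite mem_cat => /orP[/mapP[z /sF[N FN Nz] ->]|/tF//].
  exists N => //; have /submoduleP[N0 Nlin] := Fsub _ FN.
  by rewrite -[_ *: _]addr0; exact: Nlin.
move=> f _ [x [s sF ->] <-].
exists [seq f y | y <- s]; last by rewrite big_map linear_sum.
move=> _ /mapP[z /sF[N FN Nz] ->].
case: (Ff f N FN) => [FfN|fN]; first by exists (f @` N) => //; exists z.
by exists N => //; apply: fN; exists z.
Qed.

Lemma submodule_image (f : {linear M -> M}) N :
  submodule N -> submodule (f @` N).
Proof.
move=> /submoduleP[N0 Nlin]; apply/submoduleP; split.
  by exists 0; rewrite ?linear0.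
move=> a _ _ [u Nu <-] [v Nv <-].
by exists (a *: u + v); rewrite ?linearP//; exact: Nlin.
Qed.

Lemma fi_lattice_mprod N L : fi_lattice N -> fi_lattice L ->
  fi_lattice (mprod N L).
Proof.
move=> [sN _] [_ fL]; apply: fi_lattice_msum.
  by move=> _ [f _ <-]; exact: submodule_image.
move=> g _ [f fL' <-]; left; exists (g \o f); last by rewrite image_comp.
move=> _ [x _ <-] /=; apply: (fL g); exists (f x) => //.
by apply: fL'; exists x.
Qed.

Lemma mprod_sub N L : fi_lattice N -> fi_lattice L ->
  mprod N L `<=` N `&` L.
Proof.
move=> [sN fN] [sL _] x NLx; split; apply: msum_sub NLx => // _ [f fL <-].
  exact: fN.
by move=> _ [y _ <-]; apply: fL; exists y.
Qed.

Fact spec_topologyT : spec_topology setT.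
Proof.
exists setT; first exact: fi_latticeT.
apply/seteqP; split=> // -[P [fP PT pP]] _ /= TP.
by apply: (PT); apply/seteqP; split.
Qed.

Fact spec_topologyI : setI_closed spec_topology.
Proof.
move=> _ _ [N fN ->] [L fL ->]; exists (mprod N L).
  exact: fi_lattice_mprod.
have NL := mprod_sub fN fL.
apply/seteqP; split=> -[P [fP PT pP]] /=.
  by move=> [NP LP] /(pP _ _ fN fL)[].
by move=> NLP; split=> ?; apply: NLP => x /NL[]; auto.
Qed.

Fact spec_topology_bigU (I : Type) (f : I -> set spectrum) :
  (forall i, spec_topology (f i)) -> spec_topology (\bigcup_i f i).
Proof.
move=> fo.
pose F := [set N | fi_lattice N /\ exists i, f i = spec_open N].
exists (msum F).
  apply: fi_lattice_msum; first by move=> N [[]].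
  by move=> g N [[_ gN] _]; right; exact: gN.
apply/seteqP; split=> -[P [fP PT pP]] /=.
  move=> [i _]; have [N fN fE] := fo i; rewrite fE => NP FP; apply: NP => /=.
  by apply: subset_trans FP; apply: sub_msum; split=> //; exists i.
move=> FP; apply: contrapT => nP; apply: FP.
apply: msum_sub => [|N [fN [i fE]]]; first by case: (fP).
by apply: contrapT => NP; apply: nP; exists i => //; rewrite fE.
Qed.

HB.instance Definition _ := gen_eqMixin spectrum.
HB.instance Definition _ := gen_choiceMixin spectrum.
HB.instance Definition _ := isOpenTopological.Build spectrum
  spec_topologyT spec_topologyI spec_topology_bigU.

Lemma open_spectrumE (U : set spectrum) :
  open U <-> exists2 N, fi_lattice N & U = spec_open N.
Proof. by []. Qed.

End FullyInvariant.

Arguments fi_lattice {R} M.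
Arguments fi_max {R} M.
Arguments strongly_harmonic {R} M.
Arguments fi_normal {R} M.
Arguments fi_compact {R} M.
Arguments spectrum {R} M.
Arguments fi_lattice_mu {R} M.
Arguments fi_mu_normal {R} M.

(* Main.v *)
Require Import Defs.
From HB Require Import structures.
From mathcomp Require Import all_boot all_algebra.
From mathcomp Require Import boolp classical_sets functions cardinality topology.

Import GRing.Theory.
Local Open Scope classical_set_scope.
Local Open Scope ring_scope.

(** The implication from strong harmonicity to normality of the lattice is a
    compactness argument, repeated twice. Compactness of the lattice gives two
    things: every proper fully invariant submodule lies in a coatom
    ([fi_max_exists]), and a directed family of fully invariant submodules that
    is contained in no single coatom already contains [M] ([fi_max_covering]).
    Let [A + B = M]. Fix a coatom [N] above [A]. The submodules [K] with
    [K_M X = 0] for some [X] not below [N] form a directed family, and for each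
    coatom above [B] strong harmonicity provides a [K] of the family outside it;
    hence [B + K = M] for one of them. Now let [N] vary: the [X] with
    [K_M X = 0] for some [K] such that [B + K = M] form a directed family that
    escapes every coatom above [A], so [A + X = M] for one of them.

    Directedness is where the product matters. Combining [K_M X = 0] with
    [K'_M X' = 0] yields [(K + K')_M (X_M X') = 0] in the first pass and
    [(K_M K')_M (X + X') = 0] in the second. One has to know that coatoms are
    prime, so that [X_M X'] still escapes [N], and that the product distributes
    over sums in its second argument. The second fact ([mprodDr]) is the only
    use of the projectivity of [M]: a map [M -> A + B] lifts along the
    codiagonal from [A (+) B], a submodule of [M^(2)], and so splits as a sum of
    maps into [A] and into [B] ([projective_split]). Primeness of coatoms
    ([fi_max_prime]) follows from distributivity and [M_M M = M].

    The other implications translate between submodules and primes. Since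
    [mu N] is the intersection of the primes above [N] ([mu_sub_prime],
    [sub_mu_prime]), [mu (A + B) = M] says that the closed sets defined by [A]
    and [B] are disjoint, and [mu A] meets [mu B] in [mu 0] exactly when the
    open sets defined by [A] and [B] are disjoint. Normality of the nuclear
    lattice is therefore the same statement as normality of the spectrum. It
    follows from normality of the whole lattice because [mu (A + B) = M] forces
    [A + B = M], no coatom being above [A + B], and because a zero product has a
    factor in every prime. Finally, if the coatoms intersect in [0], a product
    that lies in every prime vanishes, and separating the distinct points given
    by two coatoms is strong harmonicity. *)

(** * Submodules as modules, and splitting of maps into a sum *)

Section SubmoduleType.
Set Implicit Arguments.
Unset Strict Implicit.

(** The closure proof is a parameter of the type so that the module structure
    can be inferred from the type alone. *)
Record submod_type (R : pzRingType) (V : lmodType R) (S : set V)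
    (sS : submodule S) :=
  SubmodType { submod_val :> V; _ : submod_val \in [pred x in S] }.

Variables (R : pzRingType) (V : lmodType R) (S : set V) (sS : submodule S).

HB.instance Definition _ := [isSub for @submod_val R V S sS].
HB.instance Definition _ := [Choice of submod_type sS by <:].

Fact submod_type_closed : GRing.subsemimod_closed [pred x in S].
Proof. exact: (GRing.submod_closed_semi sS). Qed.

HB.instance Definition _ :=
  GRing.SubChoice_isSubLmodule.Build R V [pred x in S] (submod_type sS)
    submod_type_closed.

Lemma submod_valP (x : submod_type sS) : S (val x).
Proof. by have := valP x; rewrite !inE. Qed.

Variables (U : lmodType R) (f : {linear U -> V}) (fS : forall x, S (f x)).

Definition corestrict (x : U) : submod_type sS :=
  @SubmodType _ _ _ sS (f x) (mem_set (fS x)).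

Fact corestrict_linear : linear corestrict.
Proof. by move=> a x y; apply: val_inj; rewrite /= !linearP. Qed.

HB.instance Definition _ :=
  GRing.isLinear.Build R U (submod_type sS) _ corestrict corestrict_linear.

End SubmoduleType.

Section Splitting.
Set Implicit Arguments.
Unset Strict Implicit.
Variables (R : pzRingType) (M : lmodType R).

Fact dsum_coord_linear (b : bool) : linear (fun x : dsum bool M => x b).
Proof. by move=> a x y; rewrite -[LHS]/(val (a *: x + y) b) linearP. Qed.

Definition codiag (x : dsum bool M) : M := x true + x false.

Fact codiag_linear : linear codiag.
Proof.
by move=> a x y; rewrite /codiag !dsum_coord_linear scalerDr addrACA.
Qed.

HB.instance Definition _ :=
  GRing.isLinear.Build R (dsum bool M) M _ codiag codiag_linear.

Lemma bool_finsupp (x : bool -> M) : x \in @finsupp R bool M.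
Proof. by rewrite inE /=; exact: finite_finset. Qed.

Variables (A B : set M) (sA : submodule A) (sB : submodule B).

Fact submodule_madd : submodule (madd A B).
Proof.
have /submoduleP[A0 Alin] := sA; have /submoduleP[B0 Blin] := sB.
apply/submoduleP; split; first by exists 0 => //; exists 0; rewrite ?addr0.
move=> r _ _ [a Aa [b Bb <-]] [a' Aa' [b' Bb' <-]].
exists (r *: a + a'); first exact: Alin.
exists (r *: b + b'); first exact: Blin.
by rewrite scalerDr addrACA.
Qed.

Let D : set (dsum bool M) := [set x | A (x true) /\ B (x false)].

Fact submodule_D : submodule D.
Proof.
have /submoduleP[A0 Alin] := sA; have /submoduleP[B0 Blin] := sB.
apply/submoduleP; split; first by split.
move=> a x y [Ax Bx] [Ay By].
by split; rewrite dsum_coord_linear; [exact: Alin | exact: Blin].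
Qed.

(** [A (+) B] is realised inside [M^(bool)], which puts it in [sigma[M]]; the
    map [f] lifts along the codiagonal [A (+) B -> A + B], and the two
    coordinates of the lift are the required summands. *)
Lemma projective_split (f : {linear M -> M}) :
  projective_in_sigma M -> range f `<=` madd A B ->
  exists g h : {linear M -> M},
    [/\ range g `<=` A, range h `<=` B & forall x, f x = g x + h x].
Proof.
move=> projM fAB.
pose N := submod_type submodule_D.
have NM : in_sigma M N.
  exists bool, (dsum bool M), idfun, (val : N -> dsum bool M); split.
    by move=> x _; exists x.
  exact: val_inj.
have cAB x : madd A B ((codiag \o (val : N -> dsum bool M)) x).
  have [Ax Bx] := submod_valP x.
  by exists (val x true) => //; exists (val x false).
have fAB' x : madd A B (f x) by apply: fAB; exists x.
have [|beta betaE] := projM N NM _ (corestrict submodule_madd cAB)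
  (corestrict submodule_madd fAB').
  move=> y _; have [a Aa [b Bb abE]] := submod_valP y.
  pose d : dsum bool M := DSum (bool_finsupp (fun i => if i then a else b)).
  have dD : D d by [].
  exists (@SubmodType _ _ _ submodule_D d (mem_set dD)) => //.
  exact/val_inj.
pose co b : {linear dsum bool M -> M} := HB.pack (fun x : dsum bool M => x b)
  (GRing.isLinear.Build R (dsum bool M) M _ _ (dsum_coord_linear b)).
exists (co true \o (val : N -> dsum bool M) \o beta).
exists (co false \o (val : N -> dsum bool M) \o beta).
split=> [_ [x _ <-]|_ [x _ <-]|x]; try by have [] := submod_valP (beta x).
exact/esym/(congr1 val (betaE x)).
Qed.

End Splitting.

(** * Sums and products of fully invariant submodules *)

Section Lattice.
Set Implicit Arguments.
Unset Strict Implicit.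
Variables (R : pzRingType) (M : lmodType R).
Implicit Types (N L K P A B C X : set M) (F : set (set M)).

Lemma submoduleD N x y : submodule N -> N x -> N y -> N (x + y).
Proof. by move=> /submoduleP[_ Nl] Nx Ny; rewrite -[x]scale1r; exact: Nl. Qed.

Lemma madd_sub N A B : submodule N -> A `<=` N -> B `<=` N -> madd A B `<=` N.
Proof.
by move=> sN AN BN _ [a /AN Na [b /BN Nb <-]]; exact: submoduleD.
Qed.

Lemma sub_maddl A B : submodule B -> A `<=` madd A B.
Proof.
move=> /submoduleP[B0 _] a Aa; exists a => //.
by exists 0; rewrite ?addr0.
Qed.

Lemma sub_maddr A B : submodule A -> B `<=` madd A B.
Proof.
move=> /submoduleP[A0 _] b Bb; exists 0 => //.
by exists b; rewrite ?add0r.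
Qed.

Lemma maddS A A' B B' : A `<=` A' -> B `<=` B' -> madd A B `<=` madd A' B'.
Proof.
move=> AA' BB' _ [a /AA' A'a [b /BB' B'b <-]].
by exists a => //; exists b.
Qed.

Lemma fi_lattice_madd A B :
  fi_lattice M A -> fi_lattice M B -> fi_lattice M (madd A B).
Proof.
move=> [sA fA] [sB fB]; split; first exact: submodule_madd.
move=> f _ [_ [a Aa [b Bb <-]] <-]; rewrite linearD.
exists (f a); first by apply: fA; exists a.
by exists (f b) => //; apply: fB; exists b.
Qed.

Lemma fi_lattice0 : fi_lattice M [set 0].
Proof.
split; last by move=> f _ [_ -> <-]; rewrite linear0.
by apply/submoduleP; split=> // a u v -> ->; rewrite scaler0 addr0.
Qed.

Lemma sub0_submodule N : submodule N -> [set 0] `<=` N.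
Proof. by move=> /submoduleP[N0 _] _ ->. Qed.

Lemma submodule_msum F : (forall N, F N -> submodule N) -> submodule (msum F).
Proof.
move=> Fsub; apply/submoduleP; split; first by exists [::]; rewrite ?big_nil.
move=> a u v [s sF ->] [t tF ->].
exists ([seq a *: y | y <- s] ++ t).
  move=> y; rewrite mem_cat => /orP[/mapP[z /sF[N FN Nz] ->]|/tF//].
  exists N => //; have /submoduleP[N0 Nlin] := Fsub _ FN.
  by rewrite -[_ *: _]addr0; exact: Nlin.
by rewrite big_cat big_map scaler_sumr.
Qed.

Lemma submodule_mprod N L : submodule N -> submodule (mprod N L).
Proof.
by move=> sN; apply: submodule_msum => _ [f _ <-]; exact: submodule_image.
Qed.

Lemma mem_mprod N L (f : {linear M -> M}) x :
  range f `<=` L -> N x -> mprod N L (f x).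
Proof.
by move=> fL Nx; apply: (@sub_msum _ _ _ (f @` N)); [exists f | exists x].
Qed.

Lemma mprod_le N L K : submodule K ->
  (forall (f : {linear M -> M}) x, range f `<=` L -> N x -> K (f x)) ->
  mprod N L `<=` K.
Proof.
by move=> sK NLK; apply: msum_sub => // _ [f fL <-] _ [x Nx <-]; exact: NLK.
Qed.

Lemma mprodS N N' L L' : submodule N' -> N `<=` N' -> L `<=` L' ->
  mprod N L `<=` mprod N' L'.
Proof.
move=> sN' NN' LL'; apply: mprod_le; first exact: submodule_mprod.
by move=> f x /subset_trans/(_ LL') fL' /NN'; exact: mem_mprod.
Qed.

Lemma mprodDl A B L : submodule A -> submodule B ->
  mprod (madd A B) L `<=` madd (mprod A L) (mprod B L).
Proof.
move=> sA sB; apply: mprod_le.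
  by apply: submodule_madd; exact: submodule_mprod.
move=> f _ fL [a Aa [b Bb <-]]; rewrite linearD.
exists (f a); first exact: mem_mprod.
by exists (f b) => //; exact: mem_mprod.
Qed.

(** Each map into [A + B] is a sum of a map into [A] and a map into [B]. *)
Lemma mprodDr N A B : projective_in_sigma M ->
  submodule N -> submodule A -> submodule B ->
  mprod N (madd A B) `<=` madd (mprod N A) (mprod N B).
Proof.
move=> projM sN sA sB; apply: mprod_le.
  by apply: submodule_madd; exact: submodule_mprod.
move=> f x fAB Nx.
have [g [h [gA hB ->]]] := projective_split sA sB projM fAB.
exists (g x); first exact: mem_mprod.
by exists (h x) => //; exact: mem_mprod.
Qed.

(** The identity of [M] is among the maps that define the product. *)
Lemma mprodTT : mprod [set: M] setT = setT.
Proof.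
apply/seteqP; split=> // x _.
exact: (@mem_mprod setT setT idfun).
Qed.

Lemma mprod_eq0 N L : fi_lattice M N -> fi_lattice M L ->
  mprod N L `<=` [set 0] -> mprod N L = [set 0].
Proof.
move=> fN fL NL0; apply/seteqP; split=> //.
by apply: sub0_submodule; case: (fi_lattice_mprod fN fL).
Qed.

(** [M = M_M M = (N + A)_M (N + B)], and all terms of the expansion other than
    [A_M B] are absorbed by [N]. *)
Lemma madd_mprodT N A B : projective_in_sigma M ->
  fi_lattice M N -> fi_lattice M A -> fi_lattice M B ->
  madd N A = setT -> madd N B = setT -> madd N (mprod A B) = setT.
Proof.
move=> projM fN fA fB NA NB; apply/seteqP; split=> //.
have [[sN _] [sA _] [sB _]] := And3 fN fA fB.
have sAB : submodule (mprod A B) by exact: submodule_mprod.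
have sNAB : submodule (madd N (mprod A B)) by exact: submodule_madd.
have NNAB : N `<=` madd N (mprod A B) by exact: sub_maddl.
rewrite -mprodTT -[X in mprod X _]NA -[X in mprod _ X]NB.
apply: subset_trans (mprodDl sN sA) _; apply: madd_sub => //.
  apply: subset_trans NNAB => x.
  by case/(mprod_sub fN (fi_lattice_madd fN fB)).
apply: subset_trans (mprodDr projM sA sN sB) _; apply: madd_sub => //.
  by apply: subset_trans NNAB => x /(mprod_sub fA fN)[].
exact: sub_maddr.
Qed.

(** * Coatoms and compactness *)

Lemma fi_max_maddT N K : fi_max M N -> fi_lattice M K -> ~ K `<=` N ->
  madd N K = setT.
Proof.
move=> [fN NT maxN] fK; apply: contra_notP => NKT.
have [[sN _] [sK _]] := (fN, fK).
rewrite -(maxN _ (fi_lattice_madd fN fK) (sub_maddl sK) NKT).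
exact: sub_maddr.
Qed.

(** If neither [K] nor [L] is below the coatom [N], then [N + K = N + L = M],
    whence [N + K_M L = M] and [K_M L] is not below [N]. *)
Lemma fi_max_prime N : projective_in_sigma M -> fi_max M N ->
  prime_submodule N.
Proof.
move=> projM maxN; have [fN NT _] := maxN; split=> // K L fK fL KLN.
apply: contrapT => /not_orP[KN LN]; apply: NT.
rewrite -(madd_mprodT projM fN fK fL); [|exact: fi_max_maddT..].
have [sN _] := fN; apply/seteqP; split; last exact: madd_sub.
by apply: sub_maddl; exact: submodule_mprod fK.1.
Qed.

Definition directed F :=
  forall N L, F N -> F L -> exists2 K, F K & madd N L `<=` K.

Lemma directed_finite F G : F !=set0 -> directed F ->
  F `<=` fi_lattice M -> finite_set G -> G `<=` F ->
  exists2 K, F K & msum G `<=` K.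
Proof.
move=> [N0 FN0] dF fF /finite_seqP[s ->] sF.
suff [K FK sK] : exists2 K, F K & forall N, N \in s -> N `<=` K.
  by exists K => //; apply: msum_sub => //; case: (fF K FK).
elim: s sF => [|N s IH] sF; first by exists N0.
have [K FK sK] : exists2 K, F K & forall N, N \in s -> N `<=` K.
  by apply: IH => L /= sL; apply: sF; rewrite /= inE sL orbT.
have FN : F N by apply: sF; rewrite /= inE eqxx.
have [L FL NKL] := dF N K FN FK; exists L => // N'.
rewrite inE => /orP[/eqP ->|/sK N'K].
  by apply: subset_trans NKL; apply: sub_maddl; case: (fF K FK).
apply: subset_trans N'K _; apply: subset_trans NKL.
by apply: sub_maddr; case: (fF N FN).
Qed.

Lemma compact_directed F : fi_compact M -> F !=set0 -> directed F ->
  F `<=` fi_lattice M -> msum F = setT -> F setT.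
Proof.
move=> compactM F0 dF fF FT.
pose T : Type := {N : set M | F N}.
have FE : range (fun t : T => sval t) = F.
  by apply/seteqP; split=> [_ [[N FN] _ <-]//|N FN]; exists (exist _ N FN).
have [|I finI IT] := @compactM T (fun t => sval t) (fun t => fF _ (svalP t)).
  by rewrite FE.
have finF := finite_image (fun t : T => sval t) finI.
have [|K FK] := directed_finite F0 dF fF finF.
  by move=> _ [[N FN] _ <-].
by rewrite IT subTset => <-.
Qed.

Lemma fi_lattice_directed_bigcup F : F !=set0 -> directed F ->
  F `<=` fi_lattice M -> fi_lattice M (\bigcup_(N in F) N).
Proof.
move=> [N0 FN0] dF fF; split.
  apply/submoduleP; split.
    by exists N0 => //; have [/submoduleP[]] := fF N0 FN0.
  move=> a u v [N FN Nu] [L FL Lv]; have [K FK NLK] := dF N L FN FL.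
  exists K => //; apply: NLK; exists (a *: u); last by exists v.
  have [/submoduleP[N00 Nlin] _] := fF N FN.
  by rewrite -[_ *: _]addr0; exact: Nlin.
move=> f _ [x [N FN Nx] <-]; exists N => //.
by apply: (fF N FN).2; exists x.
Qed.

(** Zorn's lemma applies because, by compactness, a directed union of proper
    fully invariant submodules is proper. *)
Lemma fi_max_exists S : fi_compact M -> fi_lattice M S -> S <> setT ->
  exists2 N, fi_max M N & S `<=` N.
Proof.
move=> compactM fS ST.
(* The empty chain has empty union, hence Zorn's lemma is applied to the sets
   that become proper and fully invariant once [S] is adjoined. *)
pose P X := fi_lattice M (S `|` X) /\ S `|` X <> setT.
have [F FP chainF|N [[fN NT] maxN]] := @Zorn_bigcup M P.
  pose G := S |` [set S `|` X | X in F].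
  have G0 : G !=set0 by exists S; left.
  have fG : G `<=` fi_lattice M.
    by move=> _ [->//|[X /FP[fX _] <-]].
  have dG : directed G.
    move=> N L GN GL.
    have [NL|LN] : N `<=` L \/ L `<=` N.
      case: GN GL => [->|[X FX <-]] [->|[Y FY <-]].
      - by left.
      - by left; left.
      - by right; left.
      - by case: (chainF X Y FX FY) => XY; [left|right]; exact: setUS.
    - by exists L => //; apply: madd_sub => //; case: (fG L GL).
    - by exists N => //; apply: madd_sub => //; case: (fG N GN).
  have GE : S `|` \bigcup_(X in F) X = \bigcup_(N in G) N.
    apply/seteqP; split.
      move=> x [Sx|[X FX Xx]]; first by exists S => //; left.
      by exists (S `|` X); [right; exists X|right].
    move=> x [_ [->|[X FX <-]]]; first by left.
    by case=> [|Xx]; [left|right; exists X].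
  rewrite /P GE; split; first exact: fi_lattice_directed_bigcup.
  move=> GT; have [] : G setT.
  - apply: compact_directed => //; apply/seteqP; split=> // x.
    by rewrite -GT => -[N GN Nx]; exact: (sub_msum GN).
  - by move=> /esym.
  - by move=> [X /FP[_ XT] /XT].
exists (S `|` N); last by left.
split=> // K fK SNK KT; apply: contrapT => KN.
apply: (maxN K).
  2: by rewrite /P (setUidr (subset_trans (@subsetUl _ S N) SNK)).
split; first by apply: subset_trans SNK; exact: subsetUr.
move=> KsN; apply: KN; apply/seteqP; split=> // x /KsN; by right.
Qed.

(** The sum of [F] is in no coatom, so it is [M]; by compactness finitely many
    members of [F] suffice, and they have a common upper bound in [F]. *)
Lemma fi_max_covering F : fi_compact M -> F !=set0 -> directed F ->
  F `<=` fi_lattice M ->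
  (forall N, fi_max M N -> exists2 K, F K & ~ K `<=` N) -> F setT.
Proof.
move=> compactM F0 dF fF FN; apply: compact_directed => //.
apply: contrapT => FT.
have fiF : fi_lattice M (msum F).
  by apply: fi_lattice_msum => [N /fF[]//|f N /fF[_ fN]]; right; exact: fN.
have [N maxN sFN] := fi_max_exists compactM fiF FT.
have [K FK] := FN N maxN; apply; apply: subset_trans sFN; exact: sub_msum.
Qed.

(** The covering principle applied to the family of all [B + K]: coatoms that
    do not contain [B] cause no obstruction. *)
Lemma fi_max_covering_above B F : fi_compact M -> fi_lattice M B ->
  F !=set0 -> directed F -> F `<=` fi_lattice M ->
  (forall N, fi_max M N -> B `<=` N -> exists2 K, F K & ~ K `<=` N) ->
  exists2 K, F K & madd B K = setT.
Proof.
move=> compactM fB [K0 FK0] dF fF FN.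
have [sB _] := fB; have sF K : F K -> submodule K by move=> /fF[].
apply: (@fi_max_covering [set madd B K | K in F]) => //.
- by exists (madd B K0), K0.
- move=> _ _ [K FK <-] [L FL <-]; have [N FN' KLN] := dF K L FK FL.
  exists (madd B N); first by exists N.
  have sBN : submodule (madd B N) by apply: submodule_madd => //; exact: sF.
  have BBN : B `<=` madd B N := sub_maddl (sF _ FN').
  apply: madd_sub => //; (apply: madd_sub => //).
  + apply: subset_trans (sub_maddr sB); apply: subset_trans KLN.
    exact: sub_maddl (sF _ FL).
  + apply: subset_trans (sub_maddr sB); apply: subset_trans KLN.
    exact: sub_maddr (sF _ FK).
- by move=> _ [K /fF fK <-]; exact: fi_lattice_madd.
- move=> N maxN; have [BN|BN] := pselect (B `<=` N).
    have [K FK KN] := FN N maxN BN; exists (madd B K); first by exists K.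
    by apply: contra_not KN; apply: subset_trans; exact: sub_maddr.
  exists (madd B K0); first by exists K0.
  by apply: contra_not BN; apply: subset_trans; exact: sub_maddl (sF _ FK0).
Qed.

(** * Strong harmonicity implies normality of the lattice *)

Lemma mprod0l N : fi_lattice M N -> mprod [set 0] N = [set 0].
Proof.
move=> fN; apply: mprod_eq0 => //; first exact: fi_lattice0.
by move=> x /(mprod_sub fi_lattice0 fN)[].
Qed.

Lemma mprod0r N : fi_lattice M N -> mprod N [set 0] = [set 0].
Proof.
move=> fN; apply: mprod_eq0 => //; first exact: fi_lattice0.
by move=> x /(mprod_sub fN fi_lattice0)[].
Qed.

Lemma maddC A B : madd A B = madd B A.
Proof.
by apply/seteqP; split=> _ [a ? [b ? <-]]; rewrite addrC; exists b => //;
   exists a.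
Qed.

Lemma mprod_madd_mprod_eq0 K K' X X' : fi_lattice M K -> fi_lattice M K' ->
  fi_lattice M X -> fi_lattice M X' ->
  mprod K X = [set 0] -> mprod K' X' = [set 0] ->
  mprod (madd K K') (mprod X X') = [set 0].
Proof.
move=> fK fK' fX fX' KX KX'; have XX := mprod_sub fX fX'.
apply: mprod_eq0; [exact: fi_lattice_madd|exact: fi_lattice_mprod|].
apply: subset_trans (mprodDl fK.1 fK'.1) _.
apply: madd_sub; first exact: fi_lattice0.1.
- by rewrite -KX; apply: mprodS fK.1 _ _ => // x /XX[].
- by rewrite -KX'; apply: mprodS fK'.1 _ _ => // x /XX[].
Qed.

Lemma mprod_mprod_madd_eq0 K K' X X' : projective_in_sigma M ->
  fi_lattice M K -> fi_lattice M K' -> fi_lattice M X -> fi_lattice M X' ->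
  mprod K X = [set 0] -> mprod K' X' = [set 0] ->
  mprod (mprod K K') (madd X X') = [set 0].
Proof.
move=> projM fK fK' fX fX' KX KX'; have KK := mprod_sub fK fK'.
have fKK := fi_lattice_mprod fK fK'.
apply: mprod_eq0 => //; first exact: fi_lattice_madd.
apply: subset_trans (mprodDr projM fKK.1 fX.1 fX'.1) _.
apply: madd_sub; first exact: fi_lattice0.1.
- by rewrite -KX; apply: mprodS fK.1 _ _ => // x /KK[].
- by rewrite -KX'; apply: mprodS fK'.1 _ _ => // x /KK[].
Qed.

(** Two passes of the covering principle. The first runs over the coatoms
    above [B] with a coatom [N] above [A] fixed and enlarges the left factor
    [K]; the second runs over those [N] and enlarges the right factor [X]. *)
Lemma strongly_harmonic_normal : projective_in_sigma M -> fi_compact M ->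
  strongly_harmonic M -> fi_normal M.
Proof.
move=> projM compactM harmM A B fA fB ABT.
have local N : fi_max M N -> A `<=` N -> exists K X,
    [/\ fi_lattice M K, fi_lattice M X, madd B K = setT, ~ X `<=` N &
      mprod K X = [set 0]].
  move=> maxN AN; have [fN NT primeN] := fi_max_prime projM maxN.
  pose F := [set K | fi_lattice M K /\
    exists X, [/\ fi_lattice M X, ~ X `<=` N & mprod K X = [set 0]]].
  suff [K [fK [X [fX XN KX]]] BK] : exists2 K, F K & madd B K = setT.
    by exists K, X.
  apply: fi_max_covering_above => //.
  - exists [set 0]; split; first exact: fi_lattice0.
    have fT := fi_latticeT M; exists setT; split=> //; first by rewrite subTset.
    exact: mprod0l.
  - move=> K K' [fK [X [fX XN KX]]] [fK' [X' [fX' XN' KX']]].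
    exists (madd K K') => //; split; first exact: fi_lattice_madd.
    exists (mprod X X'); split; first exact: fi_lattice_mprod.
      by move/(primeN _ _ fX fX') => [].
    exact: mprod_madd_mprod_eq0.
  - by move=> K [].
  - move=> L maxL BL; have NL : N <> L.
      have [fL LT _] := maxL => NL; apply: LT; apply/seteqP; split=> //.
      by rewrite -ABT; apply: madd_sub BL; [exact: fL.1|rewrite -NL].
    have [X [K [fX fK KL XN KX]]] := harmM N L maxN maxL NL.
    by exists K => //; split=> //; exists X.
pose F := [set X | fi_lattice M X /\
  exists K, [/\ fi_lattice M K, madd B K = setT & mprod K X = [set 0]]].
suff [X [fX [K [fK BK KX]]] AX] : exists2 X, F X & madd A X = setT.
  by exists K, X; split; rewrite // maddC.
apply: fi_max_covering_above => //.
- exists [set 0]; split; first exact: fi_lattice0.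
  exists setT; split; [exact: fi_latticeT| |exact/mprod0r/(fi_latticeT M)].
  by apply/seteqP; split=> //; exact: sub_maddr fB.1.
- move=> X X' [fX [K [fK BK KX]]] [fX' [K' [fK' BK' KX']]].
  exists (madd X X') => //; split; first exact: fi_lattice_madd.
  exists (mprod K K'); split; [exact: fi_lattice_mprod|exact: madd_mprodT|].
  exact: mprod_mprod_madd_eq0.
- by move=> X [].
- move=> N maxN AN; have [K [X [fK fX BK XN KX]]] := local N maxN AN.
  by exists X => //; split=> //; exists K.
Qed.

End Lattice.

(** * Normality of a topological space *)

Definition open_separated (T : topologicalType) :=
  forall C D : set T, closed C -> closed D -> C `&` D = set0 ->
  exists U V, [/\ open U, open V, C `<=` U, D `<=` V & U `&` V = set0].

(** The comparison of neighbourhoods that defines normality is rephrased as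
    separation of closed sets, for an arbitrary space. *)
Lemma normal_open_separatedP (T : topologicalType) :
  normal_space T <-> open_separated T.
Proof.
split=> [normT C D cC cD CD0|sepT C cC E /set_nbhsP[W [oW CW WE]]].
  have nCD : set_nbhs C (~` D).
    apply/set_nbhsP; exists (~` D); split=> //; first exact: closed_openC.
    exact/disjoints_subset.
  have [W /set_nbhsP[U [oU CU UW]] WD] := normT C cC _ nCD.
  exists U, (~` closure W); split=> //.
  - exact/closed_openC/closed_closure.
  - by move=> x Dx /WD.
  - by apply/disjoints_subset; rewrite setCK => x /UW; exact: subset_closure.
have [|U [V [oU oV CU WV UV0]]] := sepT C (~` W) cC (open_closedC oW).
  by apply/disjoints_subset; rewrite setCK.
have nCU : set_nbhs C U by apply/set_nbhsP; exists U; split.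
exists U => //.
have VW : closure U `<=` ~` V.
  rewrite closureE => x; apply; split; first exact: open_closedC.
  exact/disjoints_subset.
apply: subset_trans VW _; apply: subset_trans WE.
by apply/subsetCP; rewrite setCK.
Qed.

(** * The multiplicative nucleus and the spectrum *)

Section Spectrum.
Set Implicit Arguments.
Unset Strict Implicit.
Variables (R : pzRingType) (M : lmodType R).
Implicit Types (N L K P A B : set M).

Lemma fi_lattice_nucleus N : fi_lattice M (mu N).
Proof.
apply: fi_lattice_msum => [K [[]]//|f K [[_ fK] _]].
by right; exact: fK.
Qed.

Lemma mu_sub_prime N P : prime_submodule P -> N `<=` P -> mu N `<=` P.
Proof.
move=> primeP NP; have [fP PT _] := primeP.
apply: msum_sub => [|K [fK KN]]; first exact: fP.1.
by apply: contrapT => KP; exact: (KN (exist _ P primeP)).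
Qed.

(** With [mu_sub_prime] this identifies [mu N] with the intersection of the
    primes above [N]. *)
Lemma sub_mu_prime K N : fi_lattice M K ->
  (forall P, prime_submodule P -> N `<=` P -> K `<=` P) -> K `<=` mu N.
Proof.
move=> fK KN; apply: sub_msum; split=> // P KP NP.
exact/KP/(KN _ (svalP P)).
Qed.

Lemma sub_mu N : fi_lattice M N -> N `<=` mu N.
Proof. by move=> fN; exact: sub_mu_prime. Qed.

Lemma nucleus_fi_lattice_mu N : fi_lattice_mu M (mu N).
Proof.
split; first exact: fi_lattice_nucleus.
apply/seteqP; split; last exact/sub_mu/fi_lattice_nucleus.
apply: sub_mu_prime => [|P primeP NP]; first exact: fi_lattice_nucleus.
by apply: (mu_sub_prime primeP); exact: mu_sub_prime.
Qed.

Lemma mu_eqT N : (forall P, prime_submodule P -> ~ N `<=` P) -> mu N = setT.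
Proof.
move=> NP; apply/seteqP; split=> //; apply: sub_mu_prime.
  exact: fi_latticeT.
by move=> P primeP /(NP P primeP).
Qed.

Lemma mu_maddT_prime A B P : mu (madd A B) = setT -> prime_submodule P ->
  A `<=` P -> B `<=` P -> False.
Proof.
move=> ABT primeP AP BP; have [fP PT _] := primeP; apply: PT.
apply/seteqP; split=> //; rewrite -ABT; apply: mu_sub_prime => //.
by apply: madd_sub => //; exact: fP.1.
Qed.

Lemma fi_lattice_setI A B :
  fi_lattice M A -> fi_lattice M B -> fi_lattice M (A `&` B).
Proof.
move=> [/submoduleP[A0 Al] fA] [/submoduleP[B0 Bl] fB]; split.
  apply/submoduleP; split=> // a u v [Au Bu] [Av Bv].
  by split; [exact: Al|exact: Bl].
by move=> f _ [x [Ax Bx] <-]; split; [apply: fA|apply: fB]; exists x.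
Qed.

(** A prime contains [mu A] as soon as it contains [A], so no prime tells the
    intersection from [0]. *)
Lemma setI_mu0 A B :
  (forall P, prime_submodule P -> A `<=` P \/ B `<=` P) ->
  mu A `&` mu B = mu [set 0].
Proof.
move=> ABP; apply/seteqP; split.
  apply: sub_mu_prime => [|P primeP _].
    by apply: fi_lattice_setI; exact: fi_lattice_nucleus.
  by case: (ABP P primeP) => /(mu_sub_prime primeP) XP x [] => [/XP|_ /XP].
have mu0S N : mu [set 0] `<=` mu N.
  apply: sub_mu_prime => [|P primeP _]; first exact: fi_lattice_nucleus.
  have [fP _ _] := primeP.
  exact: mu_sub_prime primeP (sub0_submodule fP.1).
by move=> x x0; split; apply: mu0S.
Qed.

Lemma prime_mprod0 A B P : prime_submodule P -> fi_lattice M A ->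
  fi_lattice M B -> mprod A B = [set 0] -> A `<=` P \/ B `<=` P.
Proof.
move=> [fP _ primeP] fA fB AB0; apply: primeP => //.
by rewrite AB0; exact: sub0_submodule fP.1.
Qed.

(** Every proper fully invariant submodule lies in a coatom, which is prime;
    hence [mu (A + B) = M] already forces [A + B = M]. The nuclei of the
    submodules given by normality then do the job, because a prime contains one
    factor of a zero product. *)
Lemma fi_normal_mu_normal : projective_in_sigma M -> fi_compact M ->
  fi_normal M -> fi_mu_normal M.
Proof.
move=> projM compactM normM A B [fA _] [fB _] muABT.
have ABT : madd A B = setT.
  apply: contrapT => ABT.
  have [N maxN ABN] := fi_max_exists compactM (fi_lattice_madd fA fB) ABT.
  apply: (mu_maddT_prime muABT (fi_max_prime projM maxN)).
  - by apply: subset_trans ABN; exact: sub_maddl fB.1.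
  - by apply: subset_trans ABN; exact: sub_maddr fA.1.
have [A' [B' [fA' fB' AB' A'B A'B'0]]] := normM A B fA fB ABT.
have maddT_mu C D : fi_lattice M C -> fi_lattice M D ->
    madd C D = setT -> mu (madd C (mu D)) = setT.
  move=> fC fD CDT; apply: mu_eqT => P [fP PT _] CDP; apply: PT.
  apply/seteqP; split=> //; apply: subset_trans CDP; rewrite -CDT.
  by apply: maddS => //; exact: sub_mu.
exists (mu A'), (mu B'); split; try exact: nucleus_fi_lattice_mu.
- exact: maddT_mu.
- by rewrite maddC; apply: maddT_mu => //; rewrite maddC.
- by apply: setI_mu0 => // P primeP; exact: prime_mprod0.
Qed.

(** * Normality of the spectrum *)

Lemma closed_spectrumE (C : set (spectrum M)) :
  closed C -> exists2 N, fi_lattice M N & C = [set P | N `<=` sval P].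
Proof.
rewrite -openC => /open_spectrumE[N fN CN]; exists N => //.
rewrite -[C]setCK CN; apply/seteqP; split=> P /=.
  exact: contrapT.
by move=> NP; apply.
Qed.

Lemma closed_spectrum N : fi_lattice M N ->
  closed [set P : spectrum M | N `<=` sval P].
Proof. by move=> fN; rewrite -openC; apply/open_spectrumE; exists N. Qed.

Lemma open_spec_open N : fi_lattice M N -> open (@spec_open R M N).
Proof. by move=> fN; apply/open_spectrumE; exists N. Qed.

(** Disjoint closed sets are given by [A] and [B] with [mu (A + B) = M]. If [A']
    and [B'] come from normality, a prime above [A] cannot contain [B'], since
    [mu (A + B') = M]; so [B'] defines an open neighbourhood of the first closed
    set, and [A'] one of the second. *)
Lemma mu_normal_open_separated : fi_mu_normal M -> open_separated (spectrum M).
Proof.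
move=> normM _ _ /closed_spectrumE[A fA ->] /closed_spectrumE[B fB ->] AB0.
have [|A' [B' [[fA' _] [fB' _] AB' A'B A'B'0]]] := normM (mu A) (mu B)
  (nucleus_fi_lattice_mu A) (nucleus_fi_lattice_mu B).
  apply: mu_eqT => P primeP ABP.
  suff : set0 (exist _ P primeP : spectrum M) by [].
  rewrite -AB0; split=> /=; apply: subset_trans ABP.
    apply: subset_trans (sub_mu fA) _.
    exact/sub_maddl/(fi_lattice_nucleus B).1.
  apply: subset_trans (sub_mu fB) _.
  exact/sub_maddr/(fi_lattice_nucleus A).1.
exists (spec_open B'), (spec_open A'); split; try exact: open_spec_open.
- move=> [P primeP] /= AP B'P.
  by apply: (mu_maddT_prime AB' primeP) => //; exact: mu_sub_prime.
- move=> [P primeP] /= BP A'P.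
  by apply: (mu_maddT_prime A'B primeP) => //; exact: mu_sub_prime.
- apply/seteqP; split=> // -[P primeP] /= [B'P A'P].
  have [fP _ prP] := primeP; case: (prP A' B') => //.
  apply: subset_trans (mprod_sub fA' fB') _; rewrite A'B'0.
  exact: mu_sub_prime primeP (sub0_submodule fP.1).
Qed.

Lemma spec_open_disjoint A B P : spec_open A `&` spec_open B = set0 ->
  prime_submodule P -> A `<=` P \/ B `<=` P.
Proof.
move=> AB0 primeP; apply: contrapT => /not_orP AB.
suff : set0 (exist _ P primeP : spectrum M) by [].
by rewrite -AB0.
Qed.

(** Open sets separating the closed sets of [A] and [B] are given by some [B']
    and [A']; the nuclei of [A'] and [B'] witness normality. *)
Lemma open_separated_mu_normal : open_separated (spectrum M) -> fi_mu_normal M.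
Proof.
move=> sepM A B [fA _] [fB _] ABT.
have [|_ [_ [/open_spectrumE[B' fB' ->] /open_spectrumE[A' fA' ->]
    AB' BA' AB0]]] := sepM _ _ (closed_spectrum fA) (closed_spectrum fB).
  apply/seteqP; split=> // -[P primeP] /= [AP BP].
  exact: mu_maddT_prime ABT primeP AP BP.
exists (mu A'), (mu B'); split; try exact: nucleus_fi_lattice_mu.
- apply: mu_eqT => P primeP ABP; apply: (AB' (exist _ P primeP)) => /=.
    by apply: subset_trans ABP; exact/sub_maddl/(fi_lattice_nucleus B').1.
  apply: subset_trans (sub_mu fB') _; apply: subset_trans ABP.
  exact: sub_maddr fA.1.
- apply: mu_eqT => P primeP ABP; apply: (BA' (exist _ P primeP)) => /=.
    by apply: subset_trans ABP; exact/sub_maddr/(fi_lattice_nucleus A').1.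
  apply: subset_trans (sub_mu fA') _; apply: subset_trans ABP.
  exact: sub_maddl fB.1.
- apply: setI_mu0 => // P primeP.
  by have [] := spec_open_disjoint AB0 primeP; [right|left].
Qed.

(** By maximality the closed set of primes above a coatom is a single point, so
    two distinct coatoms are separated by open sets of some [N'] and [L']. The
    product [L'_M N'] lies in every prime, in particular in every coatom. *)
Lemma open_separated_strongly_harmonic : projective_in_sigma M ->
  \bigcap_(N in fi_max M) N = [set 0] ->
  open_separated (spectrum M) -> strongly_harmonic M.
Proof.
move=> projM max0 sepM N L maxN maxL NL.
have [[fN NT topN] [fL LT topL]] := (maxN, maxL).
have [primeN primeL] := (fi_max_prime projM maxN, fi_max_prime projM maxL).
have [|_ [_ [/open_spectrumE[N' fN' ->] /open_spectrumE[L' fL' ->]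
    NN' LL' NL0]]] := sepM _ _ (closed_spectrum fN) (closed_spectrum fL).
  apply/seteqP; split=> // -[P [fP PT _]] /= [NP LP]; apply: NL.
  by rewrite -(topN P fP NP PT) -(topL P fP LP PT).
exists N', L'; split=> //.
- exact: (LL' (exist _ L primeL)).
- exact: (NN' (exist _ N primeN)).
- apply: mprod_eq0 => //; rewrite -max0 => x LN'x K maxK.
  have [L'x N'x] := mprod_sub fL' fN' LN'x.
  have primeK := fi_max_prime projM maxK.
  by have [/(_ _ N'x)|/(_ _ L'x)] := spec_open_disjoint NL0 primeK.
Qed.

End Spectrum.

Theorem theorem4p18 (R : pzRingType) (M : lmodType R)
    (projM : projective_in_sigma M) (compactM : fi_compact M) :
  [/\ strongly_harmonic M -> fi_normal M,
      fi_normal M -> fi_mu_normal M,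
      fi_mu_normal M <-> normal_space (spectrum M) &
      \bigcap_(N in fi_max M) N = [set 0] ->
        [<-> strongly_harmonic M; fi_normal M; fi_mu_normal M;
             normal_space (spectrum M)]].
Proof.
have ab := strongly_harmonic_normal projM compactM.
have bc := fi_normal_mu_normal projM compactM.
have cd : fi_mu_normal M <-> normal_space (spectrum M).
  split=> [normM|/normal_open_separatedP]; last exact: open_separated_mu_normal.
  exact/normal_open_separatedP/mu_normal_open_separated.
split=> // max0; tfae=> //; [exact: cd.1|move=> /normal_open_separatedP].
exact: open_separated_strongly_harmonic.
Qed.
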